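(* Let $(\mathfrak{B},\beta)$ be a $\mathbb{Z}_2$-graded $C^*$-algebra with $\beta=\mathrm{ad}_u$ for some selfadjoint unitary $u\in\mathfrak{B}$. The $C^*$-inductive limit $\kappa:=\lim_{n\to\infty}\kappa_n$ of the sequence of Klein transformations $\kappa_n$, $n=1,2,\dots$, exists and (a) realises a $*$-isomorphism between $\mathfrak{A}_F$ and $\mathfrak{A}_X$; (b) preserves the corresponding gradings: $\kappa\circ\alpha_F=\alpha_X\circ\kappa$; (c) its transpose $\kappa^{\rm t}$ ($\psi\mapsto\psi\circ\kappa$) sends product states of a single even state on $\mathfrak{A}_X$ to the corresponding ones on $\mathfrak{A}_F$: $$\kappa^{\rm t}\big(\psi_{\varphi,\varphi,\dots}\big)=\times_{\mathbb{N}}\varphi,\qquad \varphi\in\mathcal{S}_+(\mathfrak{B}).$$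
   Context: All $C^*$-algebras are unital. A $\mathbb{Z}_2$-graded $C^*$-algebra $(\mathfrak{B},\beta)$ is a $C^*$-algebra with a $*$-automorphism $\beta$ satisfying $\beta^2=\mathrm{id}$. Put $\mathfrak{B}_\pm=\{b:\beta(b)=\pm b\}$ (even/odd, the homogeneous elements), so $b=b_++b_-$. A state $\varphi$ is even if $\varphi\circ\beta=\varphi$; $\mathcal{S}_+(\mathfrak{B})$ is the set of even states. $\mathrm{ad}_u(b)=ubu^*$. Fermi tensor product of graded $(\mathfrak{C},\gamma)$ and $(\mathfrak{B},\beta)$: on the algebraic tensor product $\mathfrak{C}\odot\mathfrak{B}$, put $\epsilon(x,y)=-1$ if the homogeneous elements $x,y$ are both odd, $\epsilon(x,y)=1$ otherwise, and define product and involution by extension of $(c\odot b)(c'\odot b')=\epsilon(b,c')\,cc'\odot bb'$ and $(c\odot b)^*=\epsilon(c,b)\,c^*\odot b^*$. For even states $\omega,\varphi$ the functional $(\omega\times\varphi)(c\odot b)=\omega(c)\varphi(b)$ is a state. $\mathfrak{C}\otimes_F\mathfrak{B}$ is the completion in the (minimal) norm $\|x\|=\sup\|\pi_{\omega\times\varphi}(x)\|$, the supremum over all even states $\omega,\varphi$, with $\pi_{\omega\times\varphi}$ the GNS representation; its grading is $\gamma\otimes_F\beta:c\otimes_F b\mapsto\gamma(c)\otimes_F\beta(b)$. $\mathfrak{C}\otimes_X\mathfrak{B}$ is the usual minimal $C^*$-tensor product, with grading $\gamma\otimes_X\beta$. Infinite products: $\mathfrak{B}^{\otimes_F m}$ and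 $\mathfrak{B}^{\otimes_X m}$ are the $m$-fold iterated products, with gradings $\beta^{\otimes_F m}$, $\beta^{\otimes_X m}$. $\mathfrak{A}_F$ is the $C^*$-inductive limit of the $\mathfrak{B}^{\otimes_F m}$ under $x\mapsto x\otimes_F 1$, with limit grading $\alpha_F=\lim\beta^{\otimes_F m}$, and $\mathfrak{A}_X$ is the $C^*$-inductive limit of the $\mathfrak{B}^{\otimes_X m}$ under $x\mapsto x\otimes_X 1$ with limit grading $\alpha_X$. For $\varphi\in\mathcal{S}_+(\mathfrak{B})$, $\times_{\mathbb{N}}\varphi$ is the state on $\mathfrak{A}_F$ whose restriction to each $\mathfrak{B}^{\otimes_F m}$ is the $m$-fold product state $\varphi\times\cdots\times\varphi$, and $\psi_{\varphi,\varphi,\dots}$ is the usual infinite product state on $\mathfrak{A}_X$. Klein transformations: if the grading of $\mathfrak{C}$ is $\mathrm{ad}_w$ with $w\in\mathfrak{C}$ a selfadjoint unitary, $\kappa_{\mathfrak{C},\mathfrak{B}}:\mathfrak{C}\otimes_F\mathfrak{B}\to\mathfrak{C}\otimes_X\mathfrak{B}$ is the $*$-isomorphism determined by $\kappa_{\mathfrak{C},\mathfrak{B}}(c\otimes_F b_+ +(cw)\otimes_F b_-)=c\otimes_X b$. The grading of $\mathfrak{B}^{\otimes_F n}$ is inner, implemented by $u\otimes_F\cdots\otimes_F u$ ($n$ factors). The sequence $\kappa_n:\mathfrak{B}^{\otimes_F(n+1)}\to\mathfrak{B}^{\otimes_X(n+1)}$ is defined inductively by $\kappa_1=\kappa_{\mathfrak{B},\mathfrak{B}}$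 and $\kappa_n=(\kappa_{n-1}\otimes_X\mathrm{id}_{\mathfrak{B}})\circ\kappa_{\mathfrak{B}^{\otimes_F n},\mathfrak{B}}$ for $n\ge2$. *)

(* Defs.v *)
From HB Require Import structures.
From mathcomp Require Import all_boot all_order all_algebra.
From mathcomp Require Import complex.
From mathcomp Require Import all_classical all_reals all_analysis.
Set Implicit Arguments.
Unset Strict Implicit.
Unset Printing Implicit Defensive.
Import Order.TTheory GRing.Theory Num.Theory.
Import numFieldNormedType.Exports.
Local Open Scope classical_set_scope.
Local Open Scope ring_scope.

(* Unital nonzero C*-algebras. The norm of a [completeNormedModType R[i]] is
   [R[i]]-valued, and in [R[i]] the relation [0 <= z] says that [z] is real and
   nonnegative. *)
Record cstarType (R : realType) := CstarType {
  cstar_base : completeNormedModType R[i];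
  cstar_one : cstar_base;
  cstar_mul : cstar_base -> cstar_base -> cstar_base;
  cstar_star : cstar_base -> cstar_base;
  cstar_mulA : associative cstar_mul;
  cstar_mul1 : left_id cstar_one cstar_mul;
  cstar_mulr1 : right_id cstar_one cstar_mul;
  cstar_mulDl : left_distributive cstar_mul +%R;
  cstar_mulDr : right_distributive cstar_mul +%R;
  cstar_one_neq0 : cstar_one != 0;
  cstar_scalel : forall (z : R[i]) x y,
    z *: cstar_mul x y = cstar_mul (z *: x) y;
  cstar_scaler : forall (z : R[i]) x y,
    z *: cstar_mul x y = cstar_mul x (z *: y);
  cstar_starK : involutive cstar_star;
  cstar_starD : {morph cstar_star : x y / x + y};
  cstar_starZ : forall (z : R[i]) x, cstar_star (z *: x) = z^* *: cstar_star x;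
  cstar_starM : forall x y,
    cstar_star (cstar_mul x y) = cstar_mul (cstar_star y) (cstar_star x);
  cstar_normM : forall x y, `|cstar_mul x y| <= `|x| * `|y|;
  cstar_normE : forall x, `|cstar_mul (cstar_star x) x| = `|x| ^+ 2
}.

Definition cstar_sort (R : realType) (A : cstarType R) : Type := cstar_base A.
Coercion cstar_sort : cstarType >-> Sortclass.

Section CstarInstances.
Context (R : realType) (A : cstarType R).
HB.instance Definition _ := CompleteNormedModule.copy (cstar_sort A) (cstar_base A).
HB.instance Definition _ := GRing.Zmodule_isNzRing.Build (cstar_sort A)
  (@cstar_mulA R A) (@cstar_mul1 R A) (@cstar_mulr1 R A)
  (@cstar_mulDl R A) (@cstar_mulDr R A) (@cstar_one_neq0 R A).
HB.instance Definition _ := GRing.Lmodule_isLalgebra.Build R[i] (cstar_sort A)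
  (@cstar_scalel R A).
HB.instance Definition _ := GRing.Lalgebra_isAlgebra.Build R[i] (cstar_sort A)
  (@cstar_scaler R A).
Definition star (x : A) : A := cstar_star x.
End CstarInstances.

(* Contractivity is automatic for *-homomorphisms between C*-algebras. *)
Record is_star_hom (R : realType) (A B : cstarType R) (f : A -> B) : Prop :=
  IsStarHom {
  star_hom_linear : linear f;
  star_hom1 : f 1 = 1;
  star_homM : {morph f : x y / x * y};
  star_homV : {morph f : x / star x};
  star_hom_le : forall x, `|f x| <= `|x|
}.

Definition is_star_iso (R : realType) (A B : cstarType R) (f : A -> B) : Prop :=
  is_star_hom f /\
  exists g : B -> A, [/\ is_star_hom g, cancel f g & cancel g f].

(* [grade] is involutive, hence, being a *-homomorphism, a *-automorphism. *)
Record gradedType (R : realType) := GradedType {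
  graded_cstar :> cstarType R;
  grade : graded_cstar -> graded_cstar;
  gradeK : involutive grade;
  grade_hom : is_star_hom grade
}.
Arguments grade {R g}.

(* Homogeneity: [p = false] for even, [p = true] for odd elements. *)
Definition has_parity (R : realType) (A : gradedType R) (p : bool) (x : A) :
    Prop :=
  grade x = (-1) ^+ p *: x.

Definition selfadjoint_unitary (R : realType) (A : cstarType R) (u : A) : Prop :=
  [/\ star u = u, star u * u = 1 & u * star u = 1].

(* The grading is ad_u. *)
Definition implements_grading (R : realType) (A : gradedType R) (u : A) : Prop :=
  forall x : A, grade x = u * x * star u.

(* Contractivity is automatic for positive unital functionals. *)
Record is_state (R : realType) (A : cstarType R) (w : A -> R[i]) : Prop :=
  IsState {
  state_linear : scalar w;
  state_ge0 : forall x, 0 <= w (star x * x);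
  state1 : w 1 = 1;
  state_le : forall x, `|w x| <= `|x|
}.

Definition is_even_state (R : realType) (A : gradedType R) (w : A -> R[i]) :
    Prop :=
  is_state w /\ w \o grade =1 w.

(* The GNS space of [w] is the completion of [A] modulo the null vectors of
   [gns_seminorm w], on which [x] acts by left multiplication; the operator
   norm may be computed on the dense image of [A]. *)
Definition gns_seminorm (R : realType) (A : cstarType R) (w : A -> R[i])
    (y : A) : R :=
  Num.sqrt (complex.Re (w (star y * y))).

Definition gns_norm (R : realType) (A : cstarType R) (w : A -> R[i]) (x : A) :
    \bar R :=
  ereal_sup [set (gns_seminorm w (x * y))%:E | y in
             [set y | gns_seminorm w y <= 1]].

(* Tensor products are completions, so determined up to isomorphism only: a
   realization is an algebra with its elementary tensors, subject to
   [is_fermi_tensor] or [is_min_tensor] below. *)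
Record tensor_data (R : realType) (C B : gradedType R) := TensorData {
  tensor_alg :> gradedType R;
  tpure : C -> B -> tensor_alg
}.

Definition is_product_state (R : realType) (C B : gradedType R)
    (T : tensor_data C B) (w : C -> R[i]) (f : B -> R[i]) (t : T -> R[i]) :
    Prop :=
  is_state t /\ forall c b, t (tpure T c b) = w c * f b.

Definition tensor_sum (R : realType) (C B : gradedType R)
    (T : tensor_data C B) (s : seq (C * B)) : T :=
  \sum_(p <- s) tpure T p.1 p.2.

Definition is_bilinear (R : realType) (C B V : lmodType R[i])
    (f : C -> B -> V) : Prop :=
  (forall c, linear (f c)) /\ (forall b, linear (f ^~ b)).

(* [T] is the completion of the algebraic tensor product of [C] and [B] in the
   norm given by the products of the states in [SC] and [SB]. The second field
   says that the span of the elementary tensors has the universal property of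
   the algebraic tensor product. *)
Record is_tensor_completion (R : realType) (C B : gradedType R)
    (SC : set (C -> R[i])) (SB : set (B -> R[i])) (T : tensor_data C B) : Prop :=
  IsTensorCompletion {
  tpure_bilinear : is_bilinear (tpure T);
  tpure_universal : forall (V : lmodType R[i]) (f : C -> B -> V),
    is_bilinear f -> forall s : seq (C * B),
    tensor_sum T s = 0 -> \sum_(p <- s) f p.1 p.2 = 0;
  tensor_dense : dense (range (tensor_sum T));
  tensor_product_state : forall w f, SC w -> SB f ->
    exists t, is_product_state (T := T) w f t;
  tensor_norm : forall s : seq (C * B),
    (complex.Re `|tensor_sum T s|)%:E =
    ereal_sup [set gns_norm t (tensor_sum T s) | t in
               [set t | exists w f, [/\ SC w, SB f &
                                        is_product_state (T := T) w f t]]];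
  tensor_grade : forall c b,
    grade (tpure T c b) = tpure T (grade c) (grade b)
}.

Record is_fermi_tensor (R : realType) (C B : gradedType R)
    (T : tensor_data C B) : Prop := IsFermiTensor {
  fermi_completion : is_tensor_completion
    [set w | is_even_state w] [set f | is_even_state f] T;
  fermiM : forall (p q : bool) (c c' : C) (b b' : B),
    has_parity p b -> has_parity q c' ->
    tpure T c b * tpure T c' b' =
    (-1) ^+ (p && q) *: tpure T (c * c') (b * b');
  fermiV : forall (p q : bool) (c : C) (b : B),
    has_parity p c -> has_parity q b ->
    star (tpure T c b) = (-1) ^+ (p && q) *: tpure T (star c) (star b)
}.

Record is_min_tensor (R : realType) (C B : gradedType R)
    (T : tensor_data C B) : Prop := IsMinTensor {
  min_completion : is_tensor_completion
    [set w | is_state w] [set f | is_state f] T;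
  minM : forall (c c' : C) (b b' : B),
    tpure T c b * tpure T c' b' = tpure T (c * c') (b * b');
  minV : forall (c : C) (b : B),
    star (tpure T c b) = tpure T (star c) (star b)
}.

Definition tensor_op (R : realType) := forall C B : gradedType R, tensor_data C B.

(* [tpow O B n] is the (n+1)-fold iterated product of [B]; likewise for
   [upow] and [is_power_state]. *)
Fixpoint tpow (R : realType) (O : tensor_op R) (B : gradedType R) (n : nat) :
    gradedType R :=
  if n is m.+1 then O (tpow O B m) B : gradedType R else B.

Definition tpow_embed (R : realType) (O : tensor_op R) (B : gradedType R)
    (n : nat) (x : tpow O B n) : tpow O B n.+1 :=
  tpure (O (tpow O B n) B) x 1.

Fixpoint upow (R : realType) (O : tensor_op R) (B : gradedType R) (u : B)
    (n : nat) : tpow O B n :=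
  if n is m.+1 then tpure (O (tpow O B m) B) (upow O u m) u else u.

Fixpoint is_power_state (R : realType) (O : tensor_op R) (B : gradedType R)
    (f : B -> R[i]) (n : nat) : (tpow O B n -> R[i]) -> Prop :=
  match n with
  | 0 => fun t => t = f
  | m.+1 => fun t => exists w : tpow O B m -> R[i],
      is_power_state f w /\ is_product_state (T := O (tpow O B m) B) w f t
  end.

(* Graded inductive limit along injective connecting maps [j]: the completion of
   the union of the [A n]. *)
Record ind_limit (R : realType) (A : nat -> gradedType R)
    (j : forall n, A n -> A n.+1) := IndLimit {
  lim_alg :> gradedType R;
  lim_in : forall n, A n -> lim_alg;
  lim_in_hom : forall n, is_star_hom (@lim_in n);
  lim_in_isometric : forall n (x : A n), `|lim_in x| = `|x|;
  lim_in_compat : forall n (x : A n), lim_in (j n x) = lim_in x;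
  lim_in_dense : dense (\bigcup_n range (@lim_in n));
  lim_in_grade : forall n (x : A n), grade (lim_in x) = lim_in (grade x)
}.

Definition tpow_limit (R : realType) (O : tensor_op R) (B : gradedType R) :=
  ind_limit (@tpow_embed R O B).

Definition is_infinite_product (R : realType) (O : tensor_op R)
    (B : gradedType R) (L : tpow_limit O B) (f : B -> R[i]) (t : L -> R[i]) :
    Prop :=
  is_state t /\ forall n, is_power_state f (fun x : tpow O B n => t (lim_in L x)).

(* The Klein transformation, for [w] a selfadjoint unitary of [C] implementing
   the grading of [C]. *)
Definition is_klein (R : realType) (C B : gradedType R) (w : C)
    (F X : tensor_data C B) (k : F -> X) : Prop :=
  is_star_iso k /\
  forall (c : C) (b0 b1 : B), has_parity false b0 -> has_parity true b1 ->
    k (tpure F c b0 + tpure F (c * w) b1) = tpure X c (b0 + b1).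

Definition is_tensor_hom (R : realType) (C B C' B' : gradedType R)
    (T : tensor_data C B) (T' : tensor_data C' B')
    (f : C -> C') (g : B -> B') (h : T -> T') : Prop :=
  is_star_hom h /\ forall c b, h (tpure T c b) = tpure T' (f c) (g b).

(* [k n] is the transformation on the (n+2)-fold product. *)
Definition klein_sequence (R : realType) (F X : tensor_op R) (B : gradedType R)
    (u : B) (k : forall n, tpow F B n.+1 -> tpow X B n.+1) : Prop :=
  is_klein u (F := F B B) (X := X B B) (k 0%N) /\
  forall n, exists (k1 : F (tpow F B n.+1) B -> X (tpow F B n.+1) B)
                   (k2 : X (tpow F B n.+1) B -> X (tpow X B n.+1) B),
    [/\ is_klein (upow F u n.+1) k1,
        is_tensor_hom (k n) idfun k2
      & k n.+1 = k2 \o k1].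

(* The inductive limit of the [k n]: they commute with the connecting maps, and
   [kappa] is the only *-homomorphism they induce between the limits. *)
Definition is_klein_limit (R : realType) (F X : tensor_op R) (B : gradedType R)
    (AF : tpow_limit F B) (AX : tpow_limit X B)
    (k : forall n, tpow F B n.+1 -> tpow X B n.+1) (kappa : AF -> AX) : Prop :=
  let intertwines (h : AF -> AX) :=
    forall n (x : tpow F B n.+1), h (lim_in AF x) = lim_in AX (k n x) in
  [/\ forall n (x : tpow F B n.+1), k n.+1 (tpow_embed x) = tpow_embed (k n x),
      is_star_hom kappa,
      intertwines kappa
    & forall h : AF -> AX, is_star_hom h -> intertwines h -> h = kappa].

(* Main.v *)
Require Import Defs.
From HB Require Import structures.
From mathcomp Require Import all_boot all_order all_algebra.
From mathcomp Require Import complex ring.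
From mathcomp Require Import all_classical all_reals all_analysis.
Set Implicit Arguments.
Unset Strict Implicit.
Unset Printing Implicit Defensive.
Import Order.TTheory GRing.Theory Num.Theory.
Import numFieldNormedType.Exports.
Local Open Scope classical_set_scope.
Local Open Scope ring_scope.

Local Notation lim_in := Defs.lim_in.

(** Each Klein transformation is given as a *-isomorphism, so the content of the
theorem is that they are compatible with everything that determines the two
inductive limits: the connecting maps, the gradings and the product states. On
elementary tensors a Klein transformation acts by
[c (x) b |-> c (x) b] for even [b] and [c (x) b |-> c w (x) b] for odd [b]
([klein_even], [klein_odd]), and this formula gives all three. The unit is even,
so [c (x) 1] is sent to [c (x) 1] and the sequence commutes with the embeddings
([klein_all_embed]). The implementing unitary [w] is itself even, so the
gradings are respected ([klein_all_grade]). An even state vanishes on odd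
elements, so a product state whose last factor is even does not see the twist by
[w], and it pulls back to the product state with the same factors
([klein_all_power_state]). These statements are carried to all finite stages by
induction, through the factorisation of the [n]-th transformation into a Klein
transformation of the last factor and [kappa_(n-1) (x) id].

Two facts have an analytic side. The map [kappa_(n-1) (x) id] is again a
*-isomorphism ([tensor_hom_iso]): states of the two factors correspond
bijectively along [kappa_(n-1)], so the suprema of GNS norms that define the two
minimal norms run over corresponding families and the map is isometric with
dense range. Then every stage of the sequence is an isometry onto the
corresponding stage, and the union of these isometries extends by completeness
to an isometric bijection of the limits ([isometry_extension]), which is a
*-homomorphism because it is one on a dense set and all operations are
Lipschitz in each variable ([limit_star_iso]). The same density argument shows
that a *-homomorphism on the limit, or on a tensor product, is determined by its
values on the generators, which gives uniqueness of the limit map and its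
compatibility with the gradings. *)

(** * Maps determined on dense subsets *)

Section DenseSubsets.
Context (K : numFieldType).

Lemma pos_lower_bound (d e : K) :
  0 < d -> 0 < e -> exists2 m : K, 0 < m & m <= d /\ m <= e.
Proof.
move=> d0 e0; have [de|/ltW ed] := real_leP (gtr0_real d0) (gtr0_real e0).
  by exists d.
by exists e.
Qed.

Lemma dense_dist (U : normedModType K) (D : set U) (x : U) (e : K) :
  dense D -> 0 < e -> exists2 y, D y & `|x - y| < e.
Proof.
move=> dD e0; have [||y [yb Dy]] := dD (ball x e).
- by exists x; exact: ballxx.
- exact: ball_open.
by exists y => //; move: yb; rewrite -ball_normE.
Qed.

(** One constant serves both maps, since in each use below the two maps are the
two sides of an identity and satisfy the same bound. *)
Lemma lipschitz_eq_dense (U V : normedModType K) (D : set U) (M : K)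
    (f g : U -> V) : dense D -> 0 <= M ->
  (forall x y, `|f x - f y| <= M * `|x - y|) ->
  (forall x y, `|g x - g y| <= M * `|x - y|) ->
  (forall x, D x -> f x = g x) -> f =1 g.
Proof.
move=> dD M0 fM gM fg x; apply/eqP; rewrite -subr_eq0 -normr_eq0 -[_ == 0]negbK.
rewrite -normr_gt0 normr_id; apply/negP => d0.
have C0 : 0 < M + M + 1 by rewrite ltr_wpDl ?addr_ge0.
have [y Dy yx] := dense_dist x dD (divr_gt0 d0 C0).
suff : `|f x - g x| < `|f x - g x| by rewrite ltxx.
rewrite {1}(_ : f x - g x = f x - f y - (g x - g y)); last first.
  by rewrite (fg y)// opprB addrA subrK.
apply: (le_lt_trans (ler_normB _ _)).
apply: (le_lt_trans (lerD (fM _ _) (gM _ _))); rewrite -mulrDl.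
move: yx; rewrite ltr_pdivlMr// mulrC; apply: le_lt_trans.
by rewrite ler_wpM2r// lerDl.
Qed.

(** The graph of the extension by continuity of [f i |-> g i], in a form
symmetric in [f] and [g], so that statements about the extension and about its
inverse need a single proof. *)
Definition approximated (U V : normedModType K) (I : Type) (f : I -> U)
    (g : I -> V) (x : U) (y : V) : Prop :=
  forall e : K, 0 < e -> exists i, `|x - f i| < e /\ `|y - g i| < e.

(** With [x = x'] this says that the approximated point is unique; in general it
makes the extension, and by symmetry its inverse, distance preserving. *)
Lemma approximated_le (U V : normedModType K) (I : Type) (f : I -> U)
    (g : I -> V) (x x' : U) (y y' : V) :
  (forall i j, `|g i - g j| = `|f i - f j|) ->
  approximated f g x y -> approximated f g x' y' ->
  `|y - y'| <= `|x - x'|.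
Proof.
move=> fg xy xy'; apply/ler_addgt0Pr => e e0.
have e40 : 0 < e / 4%:R by rewrite divr_gt0.
have [i [xi yi]] := xy _ e40; have [j [xj yj]] := xy' _ e40.
have tri (W : normedModType K) (a b c d : W) :
    `|a - d| <= `|a - b| + `|b - c| + `|d - c|.
  rewrite (_ : a - d = (a - b) + (b - c) + (c - d)); last by rewrite !subrKA.
  by rewrite (distrC d) (le_trans (ler_normD _ _))// lerD2r ler_normD.
apply: (le_trans (tri _ y (g i) (g j) y')); rewrite fg.
have h : `|f i - f j| <= `|x - x'| + e / 4 + e / 4.
  apply: (le_trans (tri _ (f i) x x' (f j))).
  rewrite distrC (distrC (f j)) [X in X + _]addrC.
  by rewrite !lerD// ltW.
have -> : `|x - x'| + e = e / 4 + (`|x - x'| + e / 4 + e / 4) + e / 4.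
  by field.
by rewrite !lerD// ltW.
Qed.

Lemma approximatedC (U V : normedModType K) (I : Type) (f : I -> U)
    (g : I -> V) x y : approximated f g x y -> approximated g f y x.
Proof. by move=> xy e /xy[i [? ?]]; exists i. Qed.

(** The values [g i] at the points [f i] close to [x] form a Cauchy filter,
because [g i] and [g j] are as close to each other as [f i] and [f j]; the point
sought is its limit. *)
Lemma approximated_total (U : normedModType K) (V : completeNormedModType K)
    (I : Type) (f : I -> U) (g : I -> V) :
  dense (range f) -> (forall i j, `|g i - g j| = `|f i - f j|) ->
  forall x, exists y, approximated f g x y.
Proof.
move=> df fg x.
pose F : set_system V :=
  [set A | exists2 e : K, 0 < e & forall i, `|x - f i| < e -> A (g i)].
have FF : ProperFilter F.
  split.
    move=> [e e0 /= F0]; have [_ [i _ <-] xi] := dense_dist x df e0.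
    exact: F0 xi.
  split; first by exists 1.
  - move=> P Q [d d0 dP] [e e0 eQ].
    have [m m0 [md me]] := pos_lower_bound d0 e0.
    by exists m => // i xi; split; [apply: dP | apply: eQ]; exact: lt_le_trans xi _.
  - by move=> P Q PQ [d d0 dP]; exists d => // i /dP/PQ.
have : cauchy F.
  apply: cauchy_exP => e e0.
  have e20 : 0 < e / 2 by rewrite divr_gt0.
  have [_ [i _ <-] xi] := dense_dist x df e20.
  exists (g i), (e / 2) => // j xj; rewrite -ball_normE/= fg.
  rewrite (_ : f i - f j = (x - f j) - (x - f i)) ; last first.
    by rewrite opprB [RHS]addrC subrKA.
  by rewrite (le_lt_trans (ler_normB _ _))// [e]splitr ltrD.
move=> Fc; have Fy := cauchy_cvg F Fc; exists (lim F) => e e0.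
have [d d0 dy] : F (ball (lim F) e) by apply: Fy; exact: nbhsx_ballx.
have [m m0 [md me]] := pos_lower_bound d0 e0.
have [_ [i _ <-] xi] := dense_dist x df m0.
exists i; split; first exact: lt_le_trans xi me.
by have := dy i (lt_le_trans xi md); rewrite -ball_normE.
Qed.

(** An isometry between dense subsets of complete spaces extends to an isometric
bijection. The common index type [I] keeps the construction symmetric: the
inverse is the extension of [g i |-> f i]. *)
Lemma isometry_extension (U V : completeNormedModType K) (I : Type)
    (f : I -> U) (g : I -> V) :
  dense (range f) -> dense (range g) ->
  (forall i j, `|g i - g j| = `|f i - f j|) ->
  exists (h : U -> V) (h' : V -> U),
    [/\ forall i, h (f i) = g i, forall i, h' (g i) = f i,
        forall x y, `|h x - h y| = `|x - y|, cancel h h' & cancel h' h].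
Proof.
move=> df dg fg.
have gf i j : `|f i - f j| = `|g i - g j| by [].
have [h hP] := choice (approximated_total df fg).
have [h' h'P] := choice (approximated_total dg gf).
have app i : approximated f g (f i) (g i).
  by move=> e e0; exists i; split; rewrite subrr normr0.
have eq0 (W : normedModType K) (a b : W) : `|a - b| <= 0 -> a = b.
  by rewrite normr_le0 subr_eq0 => /eqP.
exists h, h'; split.
- move=> i; apply: eq0; rewrite -(normr0 U) -(subrr (f i)).
  exact: approximated_le (hP _) (app i).
- move=> i; apply: eq0; rewrite -(normr0 V) -(subrr (g i)).
  exact: approximated_le (h'P _) (approximatedC (app i)).
- move=> x y; apply/le_anti/andP; split; first exact: approximated_le (hP _) (hP _).
  exact: approximated_le (approximatedC (hP _)) (approximatedC (hP _)).
- move=> x; apply: eq0; rewrite -(normr0 V) -(subrr (h x)).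
  exact: approximated_le (h'P _) (approximatedC (hP _)).
- move=> y; apply: eq0; rewrite -(normr0 U) -(subrr (h' y)).
  exact: approximated_le (hP _) (approximatedC (h'P _)).
Qed.

End DenseSubsets.

(** * Linear maps and *-homomorphisms *)

Section RawLinear.
Context (S : nzRingType) (U V : lmodType S) (f : U -> V) (fL : linear f).

Lemma raw_linear0 : f 0 = 0.
Proof. by apply: (@addIr _ (f 0)); rewrite add0r -{1}(scale1r (f 0)) -fL scale1r addr0. Qed.

Lemma raw_linearD : {morph f : x y / x + y}.
Proof. by move=> x y; rewrite -{1}(scale1r x) fL scale1r. Qed.

Lemma raw_linearZ (a : S) x : f (a *: x) = a *: f x.
Proof. by rewrite -[a *: x]addr0 fL raw_linear0 addr0. Qed.

Lemma raw_linearB : {morph f : x y / x - y}.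
Proof. by move=> x y; rewrite raw_linearD -scaleN1r raw_linearZ scaleN1r. Qed.

Lemma raw_linear_sum (I : Type) (r : seq I) (F : I -> U) :
  f (\sum_(i <- r) F i) = \sum_(i <- r) f (F i).
Proof. exact: (big_morph f raw_linearD raw_linear0). Qed.

End RawLinear.

Section StarHoms.
Context (R : realType).
Implicit Types A B C : cstarType R.

(** The C*-identity gives [|y|^2 = |y^* y| <= |y^*| |y|], hence [|y| <= |y^*|];
the involution exchanges the two sides. *)
Lemma norm_star A (x : A) : `|star x| = `|x|.
Proof.
suff le (y : A) : `|y| <= `|star y|.
  apply/le_anti/andP; split; last exact: le.
  by rewrite -{2}(cstar_starK x); exact: le.
have [->|y0] := eqVneq y 0; first by rewrite normr0.
have yp : 0 < `|y| by rewrite normr_gt0.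
by rewrite -(ler_pM2r yp) -expr2 -(cstar_normE y); exact: cstar_normM.
Qed.

Lemma starB A : {morph @star R A : x y / x - y}.
Proof.
move=> x y; rewrite /star (@cstar_starD R A x (- y)); congr (_ + _).
by rewrite -scaleN1r (@cstar_starZ R A (-1) y) rmorphN1 scaleN1r.
Qed.

Lemma star_hom_dist A B (f : A -> B) x y :
  is_star_hom f -> `|f x - f y| <= 1 * `|x - y|.
Proof.
move=> hf; rewrite mul1r -(raw_linearB (star_hom_linear hf)).
exact: star_hom_le.
Qed.

Lemma star_hom_comp A B C (f : A -> B) (g : B -> C) :
  is_star_hom f -> is_star_hom g -> is_star_hom (g \o f).
Proof.
move=> hf hg; split=> [a x y||x y|x|x] /=.
- by rewrite (star_hom_linear hf) (star_hom_linear hg).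
- by rewrite (star_hom1 hf) (star_hom1 hg).
- by rewrite (star_homM hf) (star_homM hg).
- by rewrite (star_homV hf) (star_homV hg).
- exact: le_trans (star_hom_le hg _) (star_hom_le hf _).
Qed.

Lemma star_hom_id A : is_star_hom (@idfun A).
Proof. by split. Qed.

Lemma star_iso_id A : is_star_iso (@idfun A).
Proof. by split; [|exists idfun; split] => //; exact: star_hom_id. Qed.

Lemma star_iso_comp A B C (f : A -> B) (g : B -> C) :
  is_star_iso f -> is_star_iso g -> is_star_iso (g \o f).
Proof.
move=> [hf [f' [hf' fK f'K]]] [hg [g' [hg' gK g'K]]]; split.
  exact: star_hom_comp.
by exists (f' \o g'); split; [exact: star_hom_comp|exact: can_comp|exact: can_comp].
Qed.

Lemma star_iso_norm A B (f : A -> B) x : is_star_iso f -> `|f x| = `|x|.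
Proof.
move=> [hf [g [hg fK _]]]; apply/le_anti/andP; split; first exact: star_hom_le.
by rewrite -{1}(fK x); exact: star_hom_le.
Qed.

(** The inverse inherits the algebraic identities by injectivity, and its
contractivity from the isometry. *)
Lemma isometric_star_iso A B (f : A -> B) (g : B -> A) :
  is_star_hom f -> (forall x, `|f x| = `|x|) -> cancel f g -> cancel g f ->
  is_star_iso f.
Proof.
move=> hf fN fK gK; split=> //; exists g; split=> //; split.
- by move=> a x y; apply: (can_inj fK); rewrite (star_hom_linear hf) !gK.
- by apply: (can_inj fK); rewrite gK (star_hom1 hf).
- by move=> x y; apply: (can_inj fK); rewrite (star_homM hf) !gK.
- by move=> x; apply: (can_inj fK); rewrite (star_homV hf) !gK.
- by move=> x; rewrite -{2}(gK x) fN.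
Qed.

(** The two-variable identities are extended one variable at a time: with one
variable fixed, both sides are Lipschitz in the other, with the same constant. *)
Lemma dense_star_hom A B (f : A -> B) (D : set A) :
  dense D -> (forall x y, `|f x - f y| = `|x - y|) -> f 1 = 1 ->
  (forall a x y, D x -> D y -> f (a *: x + y) = a *: f x + f y) ->
  (forall x y, D x -> D y -> f (x * y) = f x * f y) ->
  (forall x, D x -> f (star x) = star (f x)) ->
  is_star_hom f.
Proof.
move=> dD fN f1 fL fM fV.
have lin : linear f.
  move=> a x y.
  have h1 z : D z -> (fun x => f (a *: x + z)) =1 (fun x => a *: f x + f z).
    move=> Dz; apply: (lipschitz_eq_dense dD (normr_ge0 a)) => [u v|u v|u Du].
    - by rewrite fN opprD addrACA subrr addr0 -scalerBr normrZ.
    - by rewrite opprD addrACA subrr addr0 -scalerBr normrZ fN.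
    - exact: fL.
  have h2 : (fun y => f (a *: x + y)) =1 (fun y => a *: f x + f y).
    apply: (lipschitz_eq_dense dD ler01) => [u v|u v|u Du]; rewrite ?mul1r.
    - by rewrite fN opprD addrACA subrr add0r.
    - by rewrite opprD addrACA subrr add0r fN.
    - exact: h1.
  exact: h2.
have f0 := raw_linear0 lin.
have fN0 x : `|f x| = `|x| by have := fN x 0; rewrite f0 !subr0.
split=> //.
- move=> x y.
  have h1 z : D z -> (fun x => f (x * z)) =1 (fun x => f x * f z).
    move=> Dz; apply: (lipschitz_eq_dense dD (normr_ge0 z)) => [u v|u v|u Du].
    - by rewrite fN -mulrBl mulrC; exact: cstar_normM.
    - by rewrite -mulrBl -fN -(fN0 z) [X in _ <= X]mulrC; exact: cstar_normM.
    - exact: fM.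
  have h2 : (fun y => f (x * y)) =1 (fun y => f x * f y).
    apply: (lipschitz_eq_dense dD (normr_ge0 x)) => [u v|u v|u Du].
    - by rewrite fN -mulrBr; exact: cstar_normM.
    - by rewrite -mulrBr -fN -(fN0 x); exact: cstar_normM.
    - exact: h1.
  exact: h2.
- apply: (lipschitz_eq_dense dD ler01) => [u v|u v|//]; rewrite mul1r.
  + by rewrite fN -starB norm_star.
  + by rewrite -starB norm_star fN.
- by move=> x; rewrite fN0.
Qed.

End StarHoms.

(** * States and parity *)

Section States.
Context (R : realType).
Implicit Types A B : cstarType R.

Lemma state_comp A B (f : A -> B) (w : B -> R[i]) :
  is_star_hom f -> is_state w -> is_state (w \o f).
Proof.
move=> hf hw; split=> [a x y|x||x] /=.
- by rewrite (star_hom_linear hf) (state_linear hw).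
- by rewrite (star_homM hf) (star_homV hf); exact: state_ge0.
- by rewrite (star_hom1 hf) (state1 hw).
- exact: le_trans (state_le hw _) (star_hom_le hf _).
Qed.

Lemma state_dist A (w : A -> R[i]) x y :
  is_state w -> `|w x - w y| <= 1 * `|x - y|.
Proof.
move=> hw; have := raw_linearB (state_linear hw : linear (w : A -> R[i]^o)) x y.
by move=> /= <-; rewrite mul1r; exact: state_le.
Qed.

(** Pulling back along [f] restricts the supremum over test vectors of norm at
most one to those in the range of [f]. *)
Lemma gns_norm_comp A B (f : A -> B) (w : B -> R[i]) x : is_star_hom f ->
  (gns_norm (w \o f) x <= gns_norm w (f x))%E.
Proof.
move=> hf.
have gnsf y : gns_seminorm (w \o f) y = gns_seminorm w (f y).
  by rewrite /gns_seminorm /= (star_homM hf) (star_homV hf).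
apply: le_ereal_sup => _ [y y1 <-]; exists (f y) => /=.
  by rewrite -gnsf.
by rewrite gnsf (star_homM hf).
Qed.

End States.

Section Parity.
Context (R : realType) (B : gradedType R).
Implicit Types b : B.

(** The parts are [(b + beta b) / 2] and [(b - beta b) / 2]. *)
Lemma parity_decomposition b :
  exists b0 b1, [/\ has_parity false b0, has_parity true b1 & b = b0 + b1].
Proof.
have gL := star_hom_linear (grade_hom B).
exists (2^-1 *: (b + grade b)), (2^-1 *: (b - grade b)); rewrite /has_parity; split.
- by rewrite (raw_linearZ gL) (raw_linearD gL) gradeK expr0 scale1r addrC.
- by rewrite (raw_linearZ gL) (raw_linearB gL) gradeK expr1 scaleN1r -scalerN opprB.
- by rewrite -scalerDr addrACA subrr addr0 scalerDr -scalerDl -[2^-1]mul1r -splitr scale1r.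
Qed.

Lemma even1 : has_parity false (1 : B).
Proof. by rewrite /has_parity expr0 scale1r (star_hom1 (grade_hom B)). Qed.

Lemma parity0 p : has_parity p (0 : B).
Proof.
by rewrite /has_parity scaler0 (raw_linear0 (star_hom_linear (grade_hom B))).
Qed.

(** Evenness gives [f b = f (beta b) = - f b]. *)
Lemma even_state_odd (f : B -> R[i]) b :
  is_even_state f -> has_parity true b -> f b = 0.
Proof.
move=> [hf fg] ob; have := fg b; rewrite /= ob expr1.
have fL : linear (f : B -> R[i]^o) := state_linear hf.
rewrite scaleN1r -[- b]sub0r (raw_linearB fL) (raw_linear0 fL) sub0r => /eqP.
by rewrite eq_sym -addr_eq0 -mulr2n mulrn_eq0 => /eqP.
Qed.

(** A unitary commutes with itself, so it is fixed by the automorphism that it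
implements. *)
Lemma implementing_even (u : B) :
  selfadjoint_unitary u -> implements_grading u -> grade u = u /\ u * u = 1.
Proof. by move=> [us u1 u2] gu; rewrite us in u1; rewrite gu -mulrA u2 mulr1. Qed.

End Parity.

(** * Tensor products *)

Section TensorCompletions.
Context (R : realType) (C B : gradedType R).
Context (SC : set (C -> R[i])) (SB : set (B -> R[i])).
Context (T : tensor_data C B) (hT : is_tensor_completion SC SB T).

Lemma tpureDr c b b' : tpure T c (b + b') = tpure T c b + tpure T c b'.
Proof. exact: raw_linearD ((tpure_bilinear hT).1 c) _ _. Qed.

Lemma tpure0r c : tpure T c 0 = 0.
Proof. exact: raw_linear0 ((tpure_bilinear hT).1 c). Qed.

Lemma tensor_sum_ext (V : lmodType R[i]) (f g : T -> V) :
  linear f -> linear g -> (forall c b, f (tpure T c b) = g (tpure T c b)) ->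
  forall s, f (tensor_sum T s) = g (tensor_sum T s).
Proof.
move=> fL gL fg s; rewrite /tensor_sum (raw_linear_sum fL) (raw_linear_sum gL).
by apply: eq_bigr => p _.
Qed.

Lemma tensor_ext (V : normedModType R[i]) (M : R[i]) (f g : T -> V) : 0 <= M ->
  linear f -> linear g ->
  (forall x y, `|f x - f y| <= M * `|x - y|) ->
  (forall x y, `|g x - g y| <= M * `|x - y|) ->
  (forall c b, f (tpure T c b) = g (tpure T c b)) -> f =1 g.
Proof.
move=> M0 fL gL fM gM fg; apply: (lipschitz_eq_dense (tensor_dense hT) M0) => //.
by move=> _ [s _ <-]; exact: tensor_sum_ext.
Qed.

Lemma star_hom_tensor_ext (A : cstarType R) (f g : T -> A) :
  is_star_hom f -> is_star_hom g ->
  (forall c b, f (tpure T c b) = g (tpure T c b)) -> f =1 g.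
Proof.
move=> hf hg; apply: (tensor_ext ler01); try exact: star_hom_linear.
- by move=> x y; exact: star_hom_dist.
- by move=> x y; exact: star_hom_dist.
Qed.

Lemma state_tensor_ext (f g : T -> R[i]) : is_state f -> is_state g ->
  (forall c b, f (tpure T c b) = g (tpure T c b)) -> f =1 g.
Proof.
move=> hf hg.
apply: (@tensor_ext R[i]^o 1 f g ler01); try exact: state_linear.
- by move=> x y; exact: state_dist.
- by move=> x y; exact: state_dist.
Qed.

Lemma left_unit_tensor (e : T) :
  (forall c b, e * tpure T c b = tpure T c b) -> e = 1.
Proof.
move=> eP; rewrite -[LHS]mulr1.
apply: (@tensor_ext T (`|e| + 1) (fun x => e * x) idfun) => //.
- by move=> a x y; rewrite mulrDr scalerAr.
- move=> x y; rewrite -mulrBr (le_trans (cstar_normM _ _))// ler_wpM2r//.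
  by rewrite lerDl.
- by move=> x y; rewrite mulrDl mul1r lerDr mulr_ge0.
Qed.

End TensorCompletions.

Lemma Re_norm_le (R : realType) (A A' : cstarType R) (x : A) (y : A') :
  (complex.Re `|x| <= complex.Re `|y|) = (`|x| <= `|y|).
Proof. by rewrite lecE !ger0_Im ?normr_ge0// eqxx. Qed.

Section TensorHoms.
Context (R : realType) (C B C' B' : gradedType R).
Context (T : tensor_data C B) (T' : tensor_data C' B').
Context (hT : is_min_tensor T) (hT' : is_min_tensor T').
Context (f : C -> C') (g : B -> B') (h : T -> T').
Context (hf : is_star_iso f) (hg : is_star_iso g) (hh : is_tensor_hom f g h).

Let cT := min_completion hT.
Let cT' := min_completion hT'.
Let hhom : is_star_hom h := hh.1.

Lemma tensor_hom_sum s :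
  h (tensor_sum T s) = tensor_sum T' [seq (f p.1, g p.2) | p <- s].
Proof.
rewrite /tensor_sum (raw_linear_sum (star_hom_linear hhom)) big_map.
by apply: eq_bigr => p _; rewrite hh.2.
Qed.

(** Only the lower bound has content. A product state [t] of states [w] and [v]
on the source is the pullback along [h] of the product state [t'] of
[w \o f^-1] and [v \o g^-1], because the two agree on elementary tensors; so its
GNS norm at [x] is at most that of [t'] at [h x], which is one of the terms of
the supremum defining the norm of [h x]. *)
Lemma tensor_hom_norm_sum s : `|h (tensor_sum T s)| = `|tensor_sum T s|.
Proof.
apply/le_anti/andP; split; first exact: star_hom_le.
rewrite -Re_norm_le -lee_fin (tensor_norm cT) tensor_hom_sum (tensor_norm cT').
rewrite -tensor_hom_sum.
have [_ [f' [hf' fK _]]] := hf; have [_ [g' [hg' gK _]]] := hg.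
apply: ge_ereal_sup => _ [t [w [v [hw hv [ht tE]]]] <-].
have hw' := state_comp hf' hw; have hv' := state_comp hg' hv.
have [t' [ht' t'E]] := tensor_product_state cT' hw' hv'.
have -> : t = t' \o h.
  apply/funext; apply: (state_tensor_ext cT ht (state_comp hhom ht')) => c b.
  by rewrite tE /= hh.2 t'E /= fK gK.
apply: (le_trans (gns_norm_comp t' (tensor_sum T s) hhom)).
apply: ereal_sup_ubound; exists t' => //.
by exists (w \o f'), (v \o g').
Qed.

(** Being isometric, [h] has closed range, and the range contains all elementary
tensors since [f] and [g] are onto. The inverse is produced by
[isometry_extension], applied to the family [tensor_sum s |-> h (tensor_sum s)],
whose extension has to be [h]. *)
Lemma tensor_hom_iso : is_star_iso h.
Proof.
have [_ [f' [_ _ f'K]]] := hf; have [_ [g' [_ _ g'K]]] := hg.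
have hB := raw_linearB (star_hom_linear hhom).
have dh : dense (range (h \o tensor_sum T)).
  suff -> : range (h \o tensor_sum T) = range (tensor_sum T').
    exact: tensor_dense cT'.
  apply/seteqP; split=> _ [s _ <-] /=.
    by rewrite tensor_hom_sum; eexists.
  exists [seq (f' p.1, g' p.2) | p <- s] => //=.
  rewrite tensor_hom_sum -map_comp; congr (tensor_sum T' _).
  by rewrite -[RHS]map_id; apply: eq_map => -[c b] /=; rewrite f'K g'K.
have hN x : `|h x| = `|x|.
  have hd : (fun x => `|h x| : R[i]^o) =1 (fun x => `|x|).
    apply: (lipschitz_eq_dense (tensor_dense cT) ler01).
    - move=> u v; apply: le_trans _ (star_hom_dist u v hhom).
      exact: ler_dist_dist.
    - by move=> u v; rewrite mul1r ler_dist_dist.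
    - by move=> _ [s _ <-]; exact: tensor_hom_norm_sum.
  exact: hd.
have [k [k' [kE k'E kN kK k'K]]] :=
  @isometry_extension _ T T' _ (tensor_sum T) (h \o tensor_sum T)
    (tensor_dense cT) dh (fun s s' => etrans (congr1 _ (esym (hB _ _))) (hN _)).
have kh : k =1 h.
  apply: (lipschitz_eq_dense (tensor_dense cT) ler01).
  - by move=> u v; rewrite kN mul1r.
  - by move=> u v; exact: star_hom_dist.
  - by move=> _ [s _ <-]; exact: kE.
apply: (isometric_star_iso hhom hN (g := k')) => x; rewrite -kh; [exact: kK|exact: k'K].
Qed.

End TensorHoms.

(** * The Klein transformation of two factors *)

Section Klein.
Context (R : realType) (C B : gradedType R).
Context (F X : tensor_data C B) (hF : is_fermi_tensor F) (hX : is_min_tensor X).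

Lemma fermi_pure11 : tpure F 1 1 = 1.
Proof.
have cF := fermi_completion hF; apply: (left_unit_tensor cF) => c b.
have [c0 [c1 [pc0 pc1 ->]]] := parity_decomposition c.
have pureDl x y z : tpure F (x + y) z = tpure F x z + tpure F y z.
  exact: raw_linearD ((tpure_bilinear cF).2 z) _ _.
rewrite pureDl mulrDr (fermiM hF _ _ (even1 B) pc0) (fermiM hF _ _ (even1 B) pc1).
by rewrite !mul1r !expr0 !scale1r.
Qed.

Lemma fermi_pure_involution (w : C) (u : B) :
  grade w = w -> w * w = 1 -> grade u = u -> u * u = 1 ->
  grade (tpure F w u) = tpure F w u /\ tpure F w u * tpure F w u = 1.
Proof.
move=> gw ww gu uu; have cF := fermi_completion hF.
split; first by rewrite (tensor_grade cF) gw gu.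
have pu : has_parity false u by rewrite /has_parity gu expr0 scale1r.
have pw : has_parity false w by rewrite /has_parity gw expr0 scale1r.
by rewrite (fermiM hF _ _ pu pw) expr0 scale1r ww uu fermi_pure11.
Qed.

Context (w : C) (gw : grade w = w) (ww : w * w = 1).
Context (k : F -> X) (hk : is_klein w k).

Lemma klein_even c b : has_parity false b -> k (tpure F c b) = tpure X c b.
Proof.
move=> pb; have := hk.2 c b 0 pb (parity0 B true).
by rewrite (tpure0r (fermi_completion hF)) !addr0.
Qed.

(** The defining formula prescribes [k] at [(c w) (x) b]; since [w ^ 2 = 1], it is
used with [c w] in place of [c]. *)
Lemma klein_odd c b : has_parity true b -> k (tpure F c b) = tpure X (c * w) b.
Proof.
move=> pb; have := hk.2 (c * w) 0 b (parity0 B false) pb.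
by rewrite (tpure0r (fermi_completion hF)) !add0r -mulrA ww mulr1.
Qed.

Lemma klein_pure c b0 b1 : has_parity false b0 -> has_parity true b1 ->
  k (tpure F c (b0 + b1)) = tpure X c b0 + tpure X (c * w) b1.
Proof.
move=> p0 p1; rewrite (tpureDr (fermi_completion hF)).
by rewrite (raw_linearD (star_hom_linear hk.1.1)) klein_even// klein_odd.
Qed.

(** On [c (x) b] with [b] odd both sides are [- gamma(c) w (x) b], because
[gamma(w) = w]. *)
Lemma klein_grade : k \o grade =1 grade \o k.
Proof.
have cF := fermi_completion hF; have cX := min_completion hX.
apply: (star_hom_tensor_ext cF); [| |move=> c b /=].
- exact: star_hom_comp (grade_hom _) hk.1.1.
- exact: star_hom_comp hk.1.1 (grade_hom _).
have [b0 [b1 [p0 p1 ->]]] := parity_decomposition b.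
have gL := star_hom_linear (grade_hom X).
rewrite (tensor_grade cF) (raw_linearD (star_hom_linear (grade_hom B))).
rewrite [k (tpure F c _)]klein_pure// (raw_linearD gL) !(tensor_grade cX).
rewrite klein_pure; last 2 first.
- by rewrite /has_parity gradeK p0 expr0 !scale1r.
- by rewrite /has_parity gradeK p1 scalerA -expr2 sqrr_sign scale1r.
by rewrite (star_homM (grade_hom C)) gw.
Qed.

(** The twist by [w] affects only the odd part of [b], where [f] vanishes. *)
Lemma klein_product_state (v : C -> R[i]) (f : B -> R[i]) (t : X -> R[i]) :
  is_even_state f -> is_product_state v f t -> is_product_state v f (t \o k).
Proof.
move=> hf [ht tE]; split; first exact: state_comp hk.1.1 ht.
move=> c b; have [b0 [b1 [p0 p1 ->]]] := parity_decomposition b.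
have tL : linear (t : X -> R[i]^o) := state_linear ht.
have fL : linear (f : B -> R[i]^o) := state_linear hf.1.
rewrite /= klein_pure// (raw_linearD tL) (raw_linearD fL) !tE.
by rewrite (even_state_odd hf p1) mulr0 !addr0.
Qed.

End Klein.

(** * Inductive limits *)

Section InductiveLimits.
Context (R : realType) (A : nat -> gradedType R) (j : forall n, A n -> A n.+1).
Context (L : ind_limit j).

Lemma star_hom_limit_ext (C : cstarType R) (f g : L -> C) :
  is_star_hom f -> is_star_hom g ->
  (forall n (x : A n), f (lim_in L x) = g (lim_in L x)) -> f =1 g.
Proof.
move=> hf hg fg; apply: (lipschitz_eq_dense (@lim_in_dense _ _ _ L) ler01).
- by move=> x y; exact: star_hom_dist.
- by move=> x y; exact: star_hom_dist.
- by move=> _ [n _ [x _ <-]].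
Qed.

Context (A' : nat -> gradedType R) (j' : forall n, A' n -> A' n.+1).
Context (L' : ind_limit j') (k : forall n, A n -> A' n).
Hypothesis k_iso : forall n, is_star_iso (@k n).
Hypothesis k_compat : forall n (x : A n), k (j x) = j' (k x).

Lemma lift_level n m (x : A n) : (n <= m)%N -> exists y : A m,
  lim_in L x = lim_in L y /\ lim_in L' (k x) = lim_in L' (k y).
Proof.
elim: m => [|m IH]; first by rewrite leqn0 => /eqP n0; subst n; exists x.
rewrite leq_eqVlt => /predU1P[nm|/IH[y [xy kxy]]]; first by subst n; exists x.
by exists (j y); rewrite k_compat !lim_in_compat.
Qed.

Lemma common_level n m (x : A n) (y : A m) : exists p (x' y' : A p),
  [/\ lim_in L x = lim_in L x', lim_in L' (k x) = lim_in L' (k x'),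
      lim_in L y = lim_in L y' & lim_in L' (k y) = lim_in L' (k y')].
Proof.
have [x' [xx kx]] := lift_level x (leq_maxl n m).
have [y' [yy ky]] := lift_level y (leq_maxr n m).
by exists (maxn n m), x', y'.
Qed.

(** The maps [k n] define a bijection between the unions of the two towers. It
preserves distances because two elements of the union live at a common level,
where [k p] is an isometry; it is then extended to the completions. *)
Lemma limit_star_iso : exists kappa : L -> L',
  is_star_iso kappa /\
  forall n (x : A n), kappa (lim_in L x) = lim_in L' (k x).
Proof.
pose f (i : {n & A n}) := lim_in L (tagged i).
pose g (i : {n & A n}) := lim_in L' (k (tagged i)).
have fE : range f = \bigcup_n range (@lim_in _ _ _ L n).
  apply/seteqP; split=> [_ [[n x] _ <-]|_ [n _ [x _ <-]]].
    by exists n => //; exists x.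
  by exists (existT _ n x).
have gE : range g = \bigcup_n range (@lim_in _ _ _ L' n).
  apply/seteqP; split=> [_ [[n x] _ <-]|_ [n _ [x _ <-]]].
    by exists n => //; exists (k x).
  have [_ [k' [_ _ k'K]]] := k_iso n.
  by exists (existT _ n (k' x)); rewrite // /g /= k'K.
have df : dense (range f) by rewrite fE; exact: lim_in_dense.
have dg : dense (range g) by rewrite gE; exact: lim_in_dense.
have fg i i' : `|g i - g i'| = `|f i - f i'|.
  case: i i' => [n x] [m y].
  have [p [x' [y' [fx gx fy gy]]]] := common_level x y.
  rewrite /f /g /= fx gx fy gy.
  rewrite -!(raw_linearB (star_hom_linear (lim_in_hom _ _))) !lim_in_isometric.
  by rewrite -(raw_linearB (star_hom_linear (k_iso p).1)) star_iso_norm.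
have [kappa [kappa' [kE _ kN kK k'K]]] := isometry_extension df dg fg.
have kin n (x : A n) : kappa (lim_in L x) = lim_in L' (k x).
  exact: kE (existT _ n x).
have hk n := (k_iso n).1; have hL n := lim_in_hom L n; have hL' n := lim_in_hom L' n.
have khom : is_star_hom kappa.
  apply: (dense_star_hom (@lim_in_dense _ _ _ L) kN).
  - by rewrite -(star_hom1 (hL 0%N)) kin (star_hom1 (hk _)) (star_hom1 (hL' _)).
  - move=> a _ _ [n _ [x _ <-]] [m _ [y _ <-]].
    have [p [x' [y' [-> _ -> _]]]] := common_level x y.
    rewrite -(star_hom_linear (hL p)) !kin (star_hom_linear (hk p)).
    exact: star_hom_linear.
  - move=> _ _ [n _ [x _ <-]] [m _ [y _ <-]].
    have [p [x' [y' [-> _ -> _]]]] := common_level x y.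
    rewrite -(star_homM (hL p)) !kin (star_homM (hk p)).
    exact: star_homM.
  - move=> _ [n _ [x _ <-]].
    rewrite -(star_homV (hL n)) !kin (star_homV (hk n)).
    exact: star_homV.
exists kappa; split=> //; apply: (isometric_star_iso khom _ kK k'K) => x.
by have := kN x 0; rewrite (raw_linear0 (star_hom_linear khom)) !subr0.
Qed.

End InductiveLimits.

(** * The sequence of Klein transformations *)

Section KleinSequence.
Context (R : realType) (F X : tensor_op R).
Context (hF : forall C B : gradedType R, is_fermi_tensor (F C B)).
Context (hX : forall C B : gradedType R, is_min_tensor (X C B)).
Context (B : gradedType R) (u : B).
Context (hu : selfadjoint_unitary u) (hgrade : implements_grading u).
Context (k : forall n, tpow F B n.+1 -> tpow X B n.+1).
Context (hk : klein_sequence u k).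

(** The identity of [B] is put in front of the sequence, at the one-fold product,
so that the first Klein transformation arises by the same step as all the others
([klein_step]) and every induction starts from a trivial case. *)
Definition klein_all (n : nat) : tpow F B n -> tpow X B n :=
  if n is m.+1 then @k m else idfun.

Lemma upow_involution n : grade (upow F u n) = upow F u n /\
  upow F u n * upow F u n = 1.
Proof.
have [gu uu] := implementing_even hu hgrade.
elim: n => [//|n [gw ww]] /=; exact: (fermi_pure_involution (hF _ _)).
Qed.

Lemma klein_step n : exists (k1 : F (tpow F B n) B -> X (tpow F B n) B)
    (k2 : X (tpow F B n) B -> X (tpow X B n) B),
  [/\ is_klein (upow F u n) k1, is_tensor_hom (@klein_all n) idfun k2
    & @klein_all n.+1 = k2 \o k1].
Proof.
case: n => [|n]; last exact: hk.2.
by exists (@k 0%N), idfun; split=> //; exact: hk.1.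
Qed.

Lemma klein_all_iso n : is_star_iso (@klein_all n).
Proof.
elim: n => [|n IH]; first exact: star_iso_id.
have [k1 [k2 [hk1 hk2 ->]]] := klein_step n; apply: star_iso_comp hk1.1 _.
exact: (tensor_hom_iso (hX _ _) (hX _ _) IH (star_iso_id B) hk2).
Qed.

Lemma klein_all_grade n : @klein_all n \o grade =1 grade \o @klein_all n.
Proof.
elim: n => [//|n IH].
have [k1 [k2 [hk1 hk2 ->]]] := klein_step n.
have [gw ww] := upow_involution n.
have gk2 : k2 \o grade =1 grade \o k2.
  have cX := min_completion (hX (tpow F B n) B).
  have cX' := min_completion (hX (tpow X B n) B).
  apply: (star_hom_tensor_ext cX).
  - exact: star_hom_comp (grade_hom _) hk2.1.
  - exact: star_hom_comp hk2.1 (grade_hom _).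
  - move=> c b /=; rewrite (tensor_grade cX) !hk2.2 (tensor_grade cX').
    by congr (tpure _ _ _); exact: IH.
have gk1 := klein_grade (hF _ _) (hX _ _) gw ww hk1.
by move=> x; exact: etrans (congr1 k2 (gk1 x)) (gk2 (k1 x)).
Qed.

Lemma klein_all_embed n (x : tpow F B n) :
  @klein_all n.+1 (tpow_embed x) = tpow_embed (@klein_all n x).
Proof.
have [k1 [k2 [hk1 hk2 ->]]] := klein_step n; rewrite /tpow_embed /=.
by rewrite (klein_even (hF _ _) hk1)// ?hk2.2//; exact: even1.
Qed.

Lemma klein_all_power_state (phi : B -> R[i]) n (t : tpow X B n -> R[i]) :
  is_even_state phi -> is_power_state phi t ->
  is_power_state phi (t \o @klein_all n).
Proof.
move=> ephi; elim: n t => [t -> //|n IH t [v [pv tv]]].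
exists (v \o @klein_all n); split; first exact: IH.
have [k1 [k2 [hk1 hk2 ->]]] := klein_step n; have [_ ww] := upow_involution n.
have tk2 : is_product_state (v \o @klein_all n) phi (t \o k2).
  split; first exact: state_comp hk2.1 tv.1.
  by move=> c b /=; rewrite hk2.2 tv.2.
exact: (klein_product_state (hF _ _) ww hk1 ephi tk2).
Qed.

End KleinSequence.

Theorem theorem3p2 (R : realType) (F X : tensor_op R)
    (hF : forall C B : gradedType R, is_fermi_tensor (F C B))
    (hX : forall C B : gradedType R, is_min_tensor (X C B))
    (B : gradedType R) (u : B)
    (hu : selfadjoint_unitary u) (hgrade : implements_grading u)
    (AF : tpow_limit F B) (AX : tpow_limit X B)
    (k : forall n, tpow F B n.+1 -> tpow X B n.+1)
    (hk : klein_sequence u k) :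
  exists kappa : AF -> AX,
    [/\ is_klein_limit k kappa,
        is_star_iso kappa,
        kappa \o grade =1 grade \o kappa
      & forall phi : B -> R[i], is_even_state phi ->
        forall psi : AX -> R[i], is_infinite_product phi psi ->
        is_infinite_product phi (psi \o kappa)].
Proof.
have [kappa [kiso kin]] := limit_star_iso AF AX
  (klein_all_iso hX hk) (klein_all_embed hF hk).
have khom := kiso.1; exists kappa; split=> //.
- split=> [n x||n x|h hh hin].
  + exact: (klein_all_embed hF hk (n := n.+1) x).
  + exact: khom.
  + exact: (kin n.+1 x).
  (* The one-fold product is not covered by the hypothesis on [h], but it embeds
     into the two-fold one. *)
  + apply/funext; apply: star_hom_limit_ext hh khom _ => n x.
    by rewrite -lim_in_compat hin -(kin n.+1).
- apply: star_hom_limit_ext; [| |move=> n x /=].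
  + exact: star_hom_comp (grade_hom _) khom.
  + exact: star_hom_comp khom (grade_hom _).
  + rewrite lim_in_grade !kin lim_in_grade; congr (lim_in _ _).
    exact: (klein_all_grade hF hX hu hgrade hk).
- move=> phi ephi psi [hpsi ppsi]; split; first exact: state_comp.
  move=> n; have := klein_all_power_state hF hu hgrade hk ephi (ppsi n).
  by congr is_power_state; apply/funext => x /=; rewrite kin.
Qed.
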